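(* Let $k\ge1$ and $d\ge1$ be integers, let $f:\mathbb{R}\to\mathbb{R}$ be $(1,[0,1])$-triangle, and define $h:\mathbb{R}^d\to\mathbb{R}$ by $h(x):=f^k(x_1)$, where $f^k$ is the $k$-fold composition of $f$. For every $y\in\mathbb{R}^{d-1}$ define $p_y:\mathbb{R}\to\mathbb{R}^d$ by $p_y(z):=(z,y)$. Then there exist Borel probability measures $\mu$ and $\nu$ on $[0,1]^d$, where $\nu$ is the uniform distribution on $2^k+1$ points and $\mu$ is continuous and positive on exactly $[0,1]^d$ (it has a Lebesgue density positive on $[0,1]^d$ and zero elsewhere), such that every $g:\mathbb{R}^d\to\mathbb{R}$ with $\mathrm{Cr}(g\circ p_y)\le 2^{k-2}$ for every $y\in\mathbb{R}^{d-1}$ satisfies \[ \int|h-g|\,d\mu\ge\frac1{32},\qquad \int|\tilde h-\tilde g|\,d\mu\ge\frac18,\qquad \int|h-g|\,d\nu\ge\frac18,\qquad \int|\tilde h-\tilde g|\,d\nu\ge\frac14. \]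
   Context: For a real-valued function $u$ let $\tilde u(x)=\mathbf{1}[u(x)\ge1/2]$. For $u:\mathbb{R}\to\mathbb{R}$, the crossing number $\mathrm{Cr}(u)$ is the minimum number of intervals in a partition of $\mathbb{R}$ into intervals on each of which $\tilde u$ is constant. A function $f$ is $(t,[a,b])$-triangle if it is continuous on $[a,b]$ and there are points $a=a_1<a_2<\dots<a_{2t+1}=b$ with $f(a_i)=f(a_{i+2})$ for $1\le i\le 2t-1$, $f(a_1)=0$, $f(a_2)=1$, $f$ strictly increasing on $[a_i,a_{i+1}]$ for odd $i$ and strictly decreasing on $[a_i,a_{i+1}]$ for even $i$. *)

(* Defs.v *)
From HB Require Import structures.
From mathcomp Require Import all_boot all_order all_algebra.
From mathcomp Require Import all_classical all_reals all_analysis.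
Set Implicit Arguments. Unset Strict Implicit. Unset Printing Implicit Defensive.
Import Order.TTheory GRing.Theory Num.Theory.
Import numFieldNormedType.Exports.
Local Open Scope classical_set_scope.
Local Open Scope ring_scope.

Section Defs.
Variable R : realType.

Definition thr {T : Type} (u : T -> R) (x : T) : R := (nat_of_bool (2^-1 <= u x))%:R.

Definition crossing_partition (u : R -> R) (n : nat) : Prop :=
  exists I : 'I_n -> set R,
    [/\ (forall i, is_interval (I i)),
        (forall i, I i !=set0),
        (forall i j, i != j -> I i `&` I j = set0),
        (forall x, exists i, I i x) &
        (forall i x y, I i x -> I i y -> thr u x = thr u y)].

(* Cr(u) <= r  (Cr(u) is the minimum of such n, +oo if none exists) *)
Definition Cr_le (u : R -> R) (r : R) : Prop :=
  exists n : nat, crossing_partition u n /\ n%:R <= r.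

(* f is (t,[a,b])-triangle; the points a_1 < ... < a_{2t+1} are a_ 0, ..., a_ (2t) *)
Definition triangle (t : nat) (a b : R) (f : R -> R) : Prop :=
  {within `[a, b], continuous f} /\
  exists a_ : nat -> R,
    [/\ a_ 0%N = a /\ a_ (2 * t)%N = b,
        (forall i, (i < 2 * t)%N -> a_ i < a_ i.+1),
        (forall i, (i + 2 <= 2 * t)%N -> f (a_ i) = f (a_ i.+2)),
        f (a_ 0%N) = 0 /\ f (a_ 1%N) = 1 &
        (forall i, (i < 2 * t)%N -> forall u v, a_ i <= u -> u < v -> v <= a_ i.+1 ->
           if ~~ odd i then f u < f v else f v < f u)].

(* iterated one-dimensional Lebesgue integral over R^n (R^n = n.-tuple R);
   by Tonelli it is the integral w.r.t. n-dimensional Lebesgue measure for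
   nonnegative measurable integrands *)
Fixpoint iter_lebesgue_integral (n : nat) : (n.-tuple R -> \bar R) -> \bar R :=
  match n return (n.-tuple R -> \bar R) -> \bar R with
  | 0%N => fun F => F [tuple]
  | m.+1 => fun F => (\int[@lebesgue_measure R]_x
                        iter_lebesgue_integral (fun t : m.-tuple R => F [tuple of x :: t]))%E
  end.

Definition unit_cube (n : nat) : set (n.-tuple R) :=
  [set x | forall i : 'I_n, 0 <= tnth x i <= 1].

Definition has_cube_density (n : nat)
    (mu : set (n.-tuple R) -> \bar R) : Prop :=
  exists rho : n.-tuple R -> R,
    [/\ measurable_fun setT rho,
        (forall x, unit_cube x -> 0 < rho x),
        (forall x, ~ unit_cube x -> rho x = 0) &
        (forall A, measurable A ->
           mu A = iter_lebesgue_integral (fun x => ((\1_A x : R) * rho x)%:E))].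

End Defs.

(* Main.v *)
Require Import Defs.
From HB Require Import structures.
From mathcomp Require Import all_boot all_order all_algebra.
From mathcomp Require Import all_classical all_reals all_analysis.
From mathcomp Require Import measurable_realfun ring lra zify.
Import Order.TTheory GRing.Theory Num.Theory.
Import numFieldNormedType.Exports.
Local Open Scope classical_set_scope.
Local Open Scope ring_scope.

(** By the intermediate value theorem, applied k times, there are points
    p_0 < ... < p_(2^k) of [0,1] at which f^k takes the values 0, 1, 0, ..., 0.
    If R is cut into m intervals on which the thresholded g is constant, at
    most m of the pairs (p_i, p_(i+1)) are separated, and g is wrong at one
    point at least of every other pair; this settles the discrete measure nu.

    By continuity f^k stays within 1/4 of its value at p_i on an interval
    [p_i, r_i], where r_i <= p_(i+1).  The first coordinate of mu is uniform on
    [0,1] with probability 1/2, and uniform on a random [p_i, r_i] with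
    probability 1/2; the other coordinates are uniform on [0,1].  The points
    p_i + t (r_i - p_i) are ordered for every t in [0,1], so the discrete count
    applies to them and is then integrated over t and the other coordinates. *)

(** * Counting errors along an ordered sequence *)

(** Two neighbours in one cell share their thresholded value while the parity alternates, so one of
    them is an error. An error serves at most two pairs of neighbours, hence the doubling; the
    remaining pairs are separated by the partition, at most once per cell. *)
Lemma crossing_partition_errors (R : realType) (u : R -> R) (n N : nat)
    (x : nat -> R) :
  crossing_partition u n -> (forall i, (i < N)%N -> x i <= x i.+1) ->
  (N <= (\sum_(i < N.+1) (odd i != (2^-1 <= u (x i))%R)).*2 + n)%N.
Proof.
move=> [I [Iitv _ Idisj Icov Icst]] xincr.
have [c Ic] := choice (fun i => Icov (x i)).
have xmono i j : (i <= j <= N)%N -> x i <= x j.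
  move=> /andP[]; elim: j => [|j IH]; first by rewrite leqn0 => /eqP ->.
  rewrite leq_eqVlt => /orP[/eqP->//|]; rewrite ltnS => ij jN.
  by rewrite (le_trans (IH ij (ltnW jN)))// xincr.
pose e i := odd i != (2^-1 <= u (x i)).
pose brk := [set i : 'I_N | c i != c i.+1]%SET.
have brk_le : (#|brk| <= n)%N.
  (* A break is charged to the cell that it leaves. A nondecreasing sequence cannot re-enter an
     interval, so the charge is injective. *)
  rewrite -[leqRHS]card_ord -(@card_in_imset _ _ (fun i : 'I_N => c i) brk).
    exact: max_card.
  move=> i j; wlog ij : i j / (i < j)%N.
    move=> H ib jb cij; apply/val_inj/eqP => /=.
    case: (ltngtP i j) => // [ij|ji].
      by have := ij; rewrite (H i j ij ib jb cij) ltnn.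
    by have := ji; rewrite (H j i ji jb ib (esym cij)) ltnn.
  rewrite !inE => ib _ cij; case/negP: ib; apply/eqP.
  have Ici : I (c i) (x i.+1).
    apply: (Iitv (c i) (x i) (x j)); [exact: Ic|by rewrite cij; exact: Ic|].
    by rewrite !xmono//; have := ltn_ord i; have := ltn_ord j; lia.
  apply/eqP/negPn/negP => /Idisj; apply/eqP/set0P.
  by exists (x i.+1); split => //; exact: Ic.
have step (i : 'I_N) : (1 <= e i + e i.+1 + (i \in brk))%N.
  rewrite inE; case: (eqVneq (c i) (c i.+1)) => [cc|_]; last by rewrite addn1.
  have := Icst _ (x i) (x i.+1) (Ic i).
  rewrite cc => /(_ (Ic i.+1)) /eqP.
  rewrite /thr eqr_nat /e /=.
  by case: (odd i); case: (2^-1 <= u (x i)); case: (2^-1 <= u (x i.+1)).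
have : (\sum_(i < N) 1 <= \sum_(i < N) (e i + e i.+1 + (i \in brk)))%N.
  by apply: leq_sum => i _; exact: step.
have brkE : (\sum_(i < N) (i \in brk) = #|brk|)%N.
  by rewrite -sum1_card [RHS]big_mkcond; apply: eq_bigr => i _; case: (i \in brk).
(* The sums of [e i] and of [e i.+1] omit the last and the first point respectively, so each is at
   most the full error count. *)
rewrite sum1_card card_ord !big_split/= brkE => /leq_trans; apply.
apply: leq_add => //; rewrite -addnn; apply: leq_add.
  by rewrite big_ord_recr/= leq_addr.
by rewrite big_ord_recl/= leq_addl.
Qed.

(** * Alternating points and bumps of the iterates *)

(** A triangle function is known to be continuous only within [0,1]; clamping the argument gives a
    globally continuous map, whose iterates are then continuous too. *)
Lemma continuous_clamp (R : realType) (f : R -> R) :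
  {within `[0, 1], continuous f} ->
  continuous (fun x : R => f (Num.max 0 (Num.min 1 x))).
Proof.
move=> cf x.
have cl (y : R) : `[0, 1]%classic (Num.max 0 (Num.min 1 y)).
  by rewrite /= in_itv/= le_max lexx/= ge_max ler01/= ge_min lexx.
move/subspace_continuousP : cf => /(_ _ (cl x)) cf.
apply: (cvg_trans _ cf).
apply: (@cvg_comp _ _ _ (fun y => Num.max 0 (Num.min 1 y)) f _ _ (f @ within `[0, 1] (nbhs (Num.max 0 (Num.min 1 x))))) => //.
move=> A; rewrite /within/= => wA.
have : (fun y : R => Num.max 0 (Num.min 1 y)) y @[y --> x] --> Num.max 0 (Num.min 1 x).
  (* Clamping is 1-Lipschitz, so [e] itself serves as the modulus. *)
  apply/cvgrPdist_le => e e0; near=> y.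
  have : `|x - y| <= e.
    by near: y; exact: (@cvgr_dist_le _ _ _ _ _ id x).
  rewrite !ler_norml; case: (leP 1 x) => ?; case: (leP 1 y) => ?;
    case: (leP 0 x) => ?; case: (leP 0 y) => ?; rewrite ?(max_r ler01); lra.
move=> /(_ _ wA) H; apply: (@filterS _ (nbhs x) _ _ _ _ H) => y; apply; exact: cl.
Unshelve. all: by end_near.
Qed.

Lemma continuous_iter (T : topologicalType) (f : T -> T) k :
  continuous f -> continuous (iter k f).
Proof.
move=> cf; elim: k => [x|k IH x]; first exact: cvg_id.
by apply: (@continuous_comp _ _ _ (iter k f) f); [exact: IH|exact: cf].
Qed.

(* Starting from [iter 0 f = id] and the points 0, 1, the intermediate value
   theorem inserts a preimage of the peak [a] between two neighbours. *)
Lemma iter_alternating_points (R : realType) (f : R -> R) (a : R) k :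
  continuous f -> f 0 = 0 -> f a = 1 -> f 1 = 0 -> 0 < a < 1 ->
  exists p : nat -> R,
    [/\ forall i, (i <= 2 ^ k)%N -> 0 <= p i <= 1,
        forall i, (i < 2 ^ k)%N -> p i < p i.+1 &
        forall i, (i <= 2 ^ k)%N -> iter k f (p i) = (odd i)%:R].
Proof.
move=> cf f0 fa f1 /andP[a0 a1]; elim: k => [|k [p [p01 pinc pE]]].
  exists (fun i => (odd i)%:R); split.
  - by move=> [|[|]]//= _; rewrite ?lexx ?ler01.
  - by move=> [|]//= _; rewrite ltr01.
  - by [].
have ex i : exists q, (i < 2 ^ k)%N -> p i < q < p i.+1 /\ iter k f q = a.
  (* The bound on [i] sits under the existential so that [choice] yields a total function; 0 is a
     dummy value. *)
  have [ik|] := ltnP i (2 ^ k); last by exists 0.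
  have pip := pinc _ ik; have [Ei ES] := (pE _ (ltnW ik), pE _ ik).
  have : Num.min (iter k f (p i)) (iter k f (p i.+1)) <= a <=
         Num.max (iter k f (p i)) (iter k f (p i.+1)).
    rewrite Ei ES /= ge_min le_max.
    by case: (odd i) => /=; rewrite !(ltW a0) !(ltW a1) ?orbT.
  move=> /(IVT (ltW pip)) [].
    by apply: continuous_subspaceT; exact: continuous_iter.
  (* [iter k f] is 0 or 1 at the two neighbours and [a] is neither, so [q] lies strictly between
     them. *)
  move=> q; rewrite in_itv/= !le_eqVlt => /andP[/predU1P[qE|qi] /predU1P[qS|iq]] Eq.
  - by move: pip; rewrite qE qS ltxx.
  - move: Eq; rewrite -qE Ei; case: (odd i) => /= Ea.
      by rewrite -Ea ltxx in a1.
    by rewrite -Ea ltxx in a0.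
  - move: Eq; rewrite qS ES/=; case: (odd i) => /= Ea.
      by rewrite -Ea ltxx in a0.
    by rewrite -Ea ltxx in a1.
  - by exists q => _; rewrite qi iq.
have [q qP] := choice ex.
(* Old points get the even indices and new ones the odd indices: [f] sends the old values 0 and 1 to
   0, and the new value [a] to 1. *)
exists (fun j => if odd j then q j./2 else p j./2); split => j.
- rewrite expnS => jk; case: ifPn => oj.
    have jk2 : (j./2 < 2 ^ k)%N by lia.
    have [/andP[lo hi] _] := qP _ jk2.
    have /andP[l0 _] := p01 _ (ltnW jk2); have /andP[_ l1] := p01 _ jk2.
    by rewrite (ltW (le_lt_trans l0 lo)) (ltW (lt_le_trans hi l1)).
  by apply: p01; lia.
- rewrite expnS => jk /=; have jk2 : (j./2 < 2 ^ k)%N by lia.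
  have [/andP[lo hi] _] := qP _ jk2.
  by rewrite uphalf_half; case: (odd j) => /=; rewrite ?add1n ?add0n.
- rewrite expnS => jk /=; case: ifPn => oj.
    have jk2 : (j./2 < 2 ^ k)%N by lia.
    by have [_ ->] := qP _ jk2; rewrite fa.
  rewrite pE; last by lia.
  by case: (odd _).
Qed.

Lemma continuous_near_right (R : realType) (h : R -> R) (x y e : R) :
  continuous h -> x < y -> 0 < e ->
  exists r, x < r <= y /\ (forall z, x <= z <= r -> `|h z - h x| <= e).
Proof.
move=> ch xy e0.
have /cvgrPdist_le/(_ _ e0) := ch x.
move=> /nbhs_ballP [d /= d0 H].
(* Halving [d] puts the closed interval inside the open ball. *)
exists (Num.min (x + d / 2) y); split.
  rewrite lt_min xy ge_min lexx orbT !andbT.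
  by rewrite ltrDl divr_gt0.
move=> z /andP[xz]; rewrite le_min => /andP[zd _].
rewrite distrC; apply: H; rewrite /ball/= distrC ger0_norm ?subr_ge0//.
by rewrite ltrBlDl (le_lt_trans zd)// ltrD2l ltr_pdivrMr// ltr_pMr// ltr1n.
Qed.

(** [F] is [f] with clamped argument and [a] is the peak. Monotonicity on either side of the peak
    keeps the values in [0,1], which is what makes the iterates of [F] and [f] agree there. *)
Lemma triangle1_extension (R : realType) (f : R -> R) :
  triangle 1 0 1 f ->
  exists (a : R) (F : R -> R),
    [/\ continuous F, 0 < a < 1, [/\ F 0 = 0, F a = 1 & F 1 = 0] &
        forall x, 0 <= x <= 1 -> F x = f x /\ 0 <= f x <= 1].
Proof.
move=> [cf [a_ [[a0 a2] inc per [f0 f1] mono]]].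
rewrite muln1 in a2.
have := inc 0%N isT; have := inc 1%N isT; rewrite a0 a2 => a11 a10.
have fend : f 1 = 0 by rewrite -a2 -(per 0%N isT) f0.
have up := mono 0%N isT; have dn := mono 1%N isT.
rewrite /= in up dn.
rewrite a0 in f0 up; rewrite a2 in dn.
have clampE x : 0 <= x <= 1 -> Num.max 0 (Num.min 1 x) = x.
  by move=> /andP[x0 x1]; rewrite min_r// max_r.
exists (a_ 1%N), (fun x => f (Num.max 0 (Num.min 1 x))); split.
- exact: continuous_clamp.
- by rewrite a10 a11.
- by rewrite !clampE ?lexx ?ler01 ?(ltW a10) ?(ltW a11).
move=> x x01; rewrite clampE//; split=> //; move/andP: x01 => [x0 x1].
have [xa|ax] := leP x (a_ 1%N).
  apply/andP; split.
    move: x0; rewrite le_eqVlt => /predU1P[<-|x0]; first by rewrite f0.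
    by rewrite -f0 ltW// up.
  move: xa; rewrite le_eqVlt => /predU1P[->|xa]; first by rewrite f1.
  by rewrite -f1 ltW// up.
apply/andP; split; last by rewrite -f1 ltW// dn// lexx.
move: x1; rewrite le_eqVlt => /predU1P[->|x1]; first by rewrite fend.
by rewrite -fend ltW// dn// ltW.
Qed.

(** The tolerance 1/4 is half the distance from 0 or 1 to the threshold 1/2: on a bump the iterate
    stays on the side of its parity, at distance at least 1/4 from every value on the other side. *)
Lemma triangle1_iter_bumps (R : realType) (f : R -> R) (k : nat) :
  triangle 1 0 1 f ->
  exists p r : nat -> R,
    [/\ forall i, (i <= 2 ^ k)%N -> 0 <= p i <= 1,
        forall i, (i < 2 ^ k)%N -> p i < r i <= p i.+1,
        forall i, (i <= 2 ^ k)%N -> iter k f (p i) = (odd i)%:R &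
        forall i z, (i < 2 ^ k)%N -> p i <= z <= r i ->
          `|iter k f z - (odd i)%:R| <= 4^-1].
Proof.
move=> /triangle1_extension[a [F [cF a01 [F0 Fa F1] FE]]].
have iterE z : 0 <= z <= 1 -> iter k F z = iter k f z /\ 0 <= iter k f z <= 1.
  by move=> z01; elim: k => [//|k [IH1 IH2]] /=; rewrite IH1; exact: FE.
have [p [p01 pinc pE]] := @iter_alternating_points _ F a k cF F0 Fa F1 a01.
have /choice[r rP] : forall i, exists s, (i < 2 ^ k)%N -> p i < s <= p i.+1 /\
    (forall z, p i <= z <= s -> `|iter k F z - iter k F (p i)| <= 4^-1).
  move=> i.
  have [ik|] := ltnP i (2 ^ k); last by exists 0.
  have [s sP] := @continuous_near_right _ _ _ _ 4^-1
    (@continuous_iter _ F k cF) (pinc _ ik) (ltac:(by rewrite invr_gt0)).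
  by exists s.
exists p, r; split => //.
- by move=> i /rP[].
- by move=> i ik; have [<- _] := iterE _ (p01 _ ik); exact: pE.
- move=> i z ik iz; have [/andP[_ ri] rz] := rP _ ik; have := rz _ iz.
  have z01 : 0 <= z <= 1.
    have /andP[? ?] := p01 _ (ltnW ik); have /andP[? ?] := p01 _ ik.
    by move: iz; lra.
  by rewrite (pE _ (ltnW ik)); have [-> _] := iterE _ z01.
Qed.

(** * Iterated Lebesgue integrals *)

Section IteratedIntegral.
Variable R : realType.
Local Open Scope ereal_scope.
Local Notation iterint := (@iter_lebesgue_integral R _).
Local Notation lambda := (@lebesgue_measure R).

Lemma measurable_tuple_cons n :
  measurable_fun setT (fun z : R * n.-tuple R => [tuple of z.1 :: z.2]).
Proof. exact: measurable_cons. Qed.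

Lemma iterint_ge0 n (F : n.-tuple R -> \bar R) :
  (forall x, 0 <= F x) -> 0 <= iterint F.
Proof.
elim: n F => [|n IH] F F0 /=; first exact: F0.
by apply: integral_ge0 => x _; apply: IH.
Qed.

(** The parameter space is arbitrary so that the induction can move the first coordinate into it;
    Tonelli then handles the outermost integral. *)
Lemma measurable_iterint_param n d (T : measurableType d)
    (F : T * n.-tuple R -> \bar R) :
  measurable_fun setT F -> (forall z, 0 <= F z) ->
  measurable_fun setT (fun t => iterint (fun y => F (t, y))).
Proof.
elim: n d T F => [|n IH] d T F mF F0 /=.
  by apply: (measurableT_comp mF); exact: measurable_fun_pair.
pose F' (z : (T * R) * n.-tuple R) := F (z.1.1, [tuple of z.1.2 :: z.2]).
have mF' : measurable_fun setT F'.
  apply: (measurableT_comp mF); apply: measurable_fun_pair => /=.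
    by apply: measurableT_comp.
  apply: measurable_cons => //; exact: measurableT_comp.
have := IH _ _ F' mF' (fun _ => F0 _) => mI.
have I0 z : 0 <= iterint (fun y => F' (z, y)).
  by apply: iterint_ge0 => y; exact: F0.
exact: (measurable_fun_fubini_tonelli_F (m2 := lambda) _ mI I0).
Qed.

Lemma measurable_iterint_cons n (F : n.+1.-tuple R -> \bar R) :
  measurable_fun setT F -> (forall z, 0 <= F z) ->
  measurable_fun setT (fun x : R => iterint (fun y : n.-tuple R => F [tuple of x :: y])).
Proof.
move=> mF F0.
apply: (@measurable_iterint_param _ _ R (fun z => F [tuple of z.1 :: z.2])) => //.
exact: (measurableT_comp mF (measurable_tuple_cons n)).
Qed.

Lemma measurable_cons_section n (F : n.+1.-tuple R -> \bar R) (x : R) :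
  measurable_fun setT F -> measurable_fun setT (fun y : n.-tuple R => F [tuple of x :: y]).
Proof.
by move=> mF; apply: (measurableT_comp mF); exact: measurable_cons.
Qed.

Lemma le_iterint n (F G : n.-tuple R -> \bar R) :
  measurable_fun setT F -> measurable_fun setT G ->
  (forall x, 0 <= F x) -> (forall x, F x <= G x) -> iterint F <= iterint G.
Proof.
elim: n F G => [|n IH] F G mF mG F0 FG /=; first exact: FG.
have G0 x : 0 <= G x by exact: le_trans (FG x).
apply: ge0_le_integral => //.
- by move=> x _; apply: iterint_ge0.
- exact: measurable_iterint_cons.
- exact: measurable_iterint_cons.
- by move=> x _; apply: IH => //; exact: measurable_cons_section.
Qed.

Lemma iterintZ n (c : R) (F : n.-tuple R -> \bar R) :
  measurable_fun setT F -> (forall x, 0 <= F x) -> (0 <= c)%R ->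
  iterint (fun x => c%:E * F x) = c%:E * iterint F.
Proof.
move=> + + c0; elim: n F => [|n IH] F mF F0 //=.
rewrite -ge0_integralZl//.
- apply: eq_integral => x _; rewrite IH//; exact: measurable_cons_section.
- exact: measurable_iterint_cons.
- by move=> x _; apply: iterint_ge0.
Qed.

Lemma iterint_sum n (I : Type) (s : seq I) (F : I -> n.-tuple R -> \bar R) :
  (forall i, measurable_fun setT (F i)) -> (forall i x, 0 <= F i x) ->
  iterint (fun x => \sum_(i <- s) F i x) = \sum_(i <- s) iterint (F i).
Proof.
elim: n F => [|n IH] F mF F0 //=.
rewrite -ge0_integral_sum//.
- apply: eq_integral => x _; rewrite IH// => i; exact: measurable_cons_section.
- by move=> i; exact: measurable_iterint_cons.
- by move=> i x _; apply: iterint_ge0.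
Qed.

(** This is the source of countable additivity for measures defined by a density; the series passes
    through one integral at a time. *)
Lemma iterint_nneseries n (F : nat -> n.-tuple R -> \bar R) :
  (forall i, measurable_fun setT (F i)) -> (forall i x, 0 <= F i x) ->
  iterint (fun x => \sum_(i <oo) F i x) = \sum_(i <oo) iterint (F i).
Proof.
elim: n F => [|n IH] F mF F0 //=.
rewrite -integral_nneseries//.
- apply: eq_integral => x _; rewrite IH// => i; exact: measurable_cons_section.
- by move=> i; exact: measurable_iterint_cons.
- by move=> i x _; apply: iterint_ge0.
Qed.

Lemma measurable_unit_cube n : measurable (@unit_cube R n).
Proof.
rewrite (_ : @unit_cube R n = \bigcap_(i in [set: 'I_n])
    ((fun x : n.-tuple R => tnth x i) @^-1` `[0%R, 1%R]%classic)); last first.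
  apply/seteqP; split => x /= H i; first by move=> _; rewrite /= in_itv/=.
  by have := H i I; rewrite /= in_itv/=.
apply: fin_bigcap_measurable => // i _.
by rewrite -[X in measurable X]setTI; exact: measurable_tnth.
Qed.

Lemma unit_cube_cons n (x : R) (y : n.-tuple R) :
  unit_cube [tuple of x :: y] <-> (0 <= x <= 1)%R /\ unit_cube y.
Proof.
split=> [H|[Hx Hy] i].
  split; first by have := H ord0; rewrite tnth0.
  by move=> i; have := H (lift ord0 i); rewrite tnthS.
by case: (unliftP ord0 i) => [j|] ->; rewrite ?tnthS ?tnth0.
Qed.

Lemma indic_unit_cube_cons n (x : R) (y : n.-tuple R) :
  \1_(@unit_cube R n.+1) [tuple of x :: y] =
  (\1_(`[0%R, 1%R]%classic) x * \1_(@unit_cube R n) y)%R :> R.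
Proof.
rewrite !indicE -natrM mulnb; congr (_%:R); congr nat_of_bool.
apply/idP/andP => [|[]]; rewrite !inE.
  by move=> /unit_cube_cons[? ?]; split => //=; rewrite in_itv.
by rewrite /= in_itv/= => ? ?; apply/unit_cube_cons.
Qed.

Lemma measurable_indic_EFin d (T : measurableType d) (A : set T) :
  measurable A -> measurable_fun setT (fun x => (\1_A x : R)%:E).
Proof. by move=> mA; apply/measurable_EFinP; exact: measurable_indic. Qed.

Lemma iterint_unit_cube n : iterint (fun x => (\1_(@unit_cube R n) x : R)%:E) = 1.
Proof.
elim: n => [|n IH] /=; first by rewrite indicE mem_set// => -[].
transitivity (\int[lambda]_x (\1_(`[0%R, 1%R]%classic) x : R)%:E); last first.
  by rewrite integral_indic//= setIT lebesgue_measure_itv/= lte01 oppr0 adde0.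
apply: eq_integral => x _; under eq_fun do rewrite indic_unit_cube_cons EFinM.
rewrite iterintZ ?IH ?mule1//.
by apply: measurable_indic_EFin; exact: measurable_unit_cube.
Qed.

End IteratedIntegral.

(** * Affine change of variable *)

Section AffineSubstitution.
Variable R : realType.
Local Open Scope ereal_scope.
Local Notation lambda := (@lebesgue_measure R).

(** The right-hand side is a scaled pushforward of Lebesgue measure that gives half-open intervals
    their length, so uniqueness of Lebesgue measure applies. *)
Lemma lebesgue_measure_affine (p L : R) (L0 : (0 < L)%R) (A : set R) :
  measurable A ->
  lambda A = L%:E * lambda ((fun t : R => p + t * L)%R @^-1` A).
Proof.
move=> mA.
have mphi : measurable_fun [set: measurableTypeR R]
    (fun t => p + t * L : measurableTypeR R)%R.
  by apply: measurable_funD => //; apply: measurable_funM.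
pose Lnn : {nonneg R} := NngNum (ltW L0).
pose m : {measure set (measurableTypeR R) -> \bar R} :=
  measure_function_pushforward__canonical__measure_function_Measure lambda mphi.
rewrite (@lebesgue_measure_unique _ (mscale Lnn m)) => //.
move=> _ [[a b]] _ <-.
transitivity (L%:E * lambda `]((a - p) / L)%R, ((b - p) / L)%R]%classic); last first.
  rewrite /mscale/=; congr (_ * lambda _).
  apply/seteqP; split => t /=; rewrite !in_itv/=;
    by rewrite ltr_pdivrMr// ler_pdivlMr// ltrBlDl lerBrDl.
rewrite !lebesgue_measure_itv/= !lte_fin ltr_pM2r ?invr_gt0// ltrD2r.
case: ifPn => // ab; last by rewrite mule0.
by rewrite -!EFinD -EFinM; congr EFin; field; exact: lt0r_neq0.
Qed.

Lemma ge0_integral_affine (p r : R) (G : R -> \bar R) :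
  (p < r)%R -> measurable_fun setT G -> (forall x, 0 <= G x) ->
  \int[lambda]_(x in `[p, r]) G x =
  (r - p)%:E * \int[lambda]_(t in `[0%R, 1%R]) G (p + t * (r - p))%R.
Proof.
move=> pr mG G0; set L := (r - p)%R.
have L0 : (0 < L)%R by rewrite subr_gt0.
have mphi : measurable_fun [set: measurableTypeR R]
    (fun t => p + t * L : measurableTypeR R)%R.
  by apply: measurable_funD => //; apply: measurable_funM.
pose Lnn : {nonneg R} := NngNum (ltW L0).
pose m : {measure set (measurableTypeR R) -> \bar R} :=
  measure_function_pushforward__canonical__measure_function_Measure lambda mphi.
rewrite (@eq_measure_integral _ _ _ _ (mscale Lnn m)); last first.
  by move=> A mA _; exact: (lebesgue_measure_affine p _ L0).
rewrite ge0_integral_mscale//=; last exact: measurable_funTS.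
rewrite ge0_integral_pushforward//=; last exact: measurable_funTS.
congr (_ * _); congr (integral _ _ _).
apply/seteqP; split => t /=; rewrite !in_itv/=;
  by rewrite lerDl pmulr_lge0// -lerBrDl ger_pMl.
Qed.

End AffineSubstitution.

(** * Probability measures given by a density *)

Section DensityProbability.
Import HBNNSimple.
Variable R : realType.
Local Open Scope ereal_scope.

Lemma density_probability n (rho : n.-tuple R -> R) :
  measurable_fun setT rho -> (forall x, (0 <= rho x)%R) ->
  iter_lebesgue_integral (fun x => (rho x)%:E) = 1 ->
  exists mu : probability (n.-tuple R) R, forall A,
    mu A = iter_lebesgue_integral (fun x => ((\1_A x : R) * rho x)%:E).
Proof.
move=> mrho rho0 rho1.
pose m (A : set (n.-tuple R)) : \bar R :=
  iter_lebesgue_integral (fun x => ((\1_A x : R) * rho x)%:E).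
have irho_ge0 (A : set (n.-tuple R)) x : 0 <= ((\1_A x : R) * rho x)%:E.
  by rewrite lee_fin mulr_ge0.
have mirho A : measurable A ->
    measurable_fun setT (fun x : n.-tuple R => ((\1_A x : R) * rho x)%:E).
  move=> mA; apply/measurable_EFinP; apply: measurable_funM => //.
have m_set0 : m set0 = 0.
  rewrite /m -[RHS](mul0e (iter_lebesgue_integral (fun x => (rho x)%:E))).
  rewrite -iterintZ//; last exact/measurable_EFinP.
  by congr iter_lebesgue_integral; apply/funext => x; rewrite indic0 -EFinM.
have m_ge0 A : 0 <= m A by apply: iterint_ge0.
have m_sigma : semi_sigma_additive m.
  move=> F mF tF mUF; apply: cvg_toP.
    by apply: is_cvg_nneseries => *; exact: m_ge0.
  rewrite -iterint_nneseries//; last by move=> i; exact: mirho.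
  congr iter_lebesgue_integral; apply/funext => x.
  (* By disjointness at most one term of the series is nonzero at [x]. *)
  have [[k _ Fkx]|nFx] := pselect ((\bigcup_k F k) x).
    rewrite (@nneseriesD1 R _ k xpredT)//= eseries0.
      by rewrite adde0 !indicE !mem_set//; exists k.
    move=> i _ ik; rewrite indicE memNset ?mul0r// => Fix.
    have E := tF i k I I (ex_intro _ x (conj Fix Fkx)).
    by move: ik; rewrite E eqxx.
  rewrite indicE memNset// mul0r eseries0// => i _ _.
  by rewrite indicE memNset ?mul0r// => Fix; apply: nFx; exists i.
have mT : m setT = 1.
  by rewrite /m -rho1; congr iter_lebesgue_integral; apply/funext => x;
    rewrite indicT mul1r.
pose mM := isMeasure.Build _ _ _ m m_set0 m_ge0 m_sigma.
pose M : {measure set (n.-tuple R) -> \bar R} := HB.pack m mM.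
pose mP := Measure_isProbability.Build _ _ _ M mT.
pose P : probability (n.-tuple R) R := HB.pack m mM mP.
by exists P.
Qed.

(* [F] need not be measurable: outside the cube nothing is known about f. *)
Lemma ge0_integral_ge_indic d (T : measurableType d)
    (mu : {measure set T -> \bar R}) (E : set T) (c : R) (F : T -> R) :
  measurable E -> (0 <= c)%R -> (forall x, (0 <= F x)%R) ->
  (forall x, E x -> (c <= F x)%R) -> c%:E * mu E <= \int[mu]_x (F x)%:E.
Proof.
move=> mE c0 F0 cF; rewrite ge0_integralTE; last by move=> x; rewrite lee_fin.
(* This simple function lies below [F], hence competes in the supremum defining the integral. *)
pose s := scale_nnsfun (indic_nnsfun R mE) c0.
apply: ereal_sup_ubound; exists s => /=.
  move=> x; rewrite lee_fin /s/= mindicE.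
  have [/[!inE] Ex|_] := boolP (x \in E); last by rewrite mulr0.
  by rewrite mulr1 cF.
transitivity (c%:E * sintegral mu (indic_nnsfun R mE)).
  by rewrite -sintegralrM; apply: eq_sintegral.
by rewrite sintegral_indic.
Qed.

End DensityProbability.

(** * The density of [mu] and the error set *)

Section BumpDensity.
Variables (R : realType) (n N : nat) (p r : nat -> R).
Hypothesis N0 : (0 < N)%N.
Hypothesis p0 : forall i, (i < N)%N -> 0 <= p i.
Hypothesis pr : forall i, (i < N)%N -> p i < r i.
Hypothesis r1 : forall i, (i < N)%N -> r i <= 1.
Local Notation lambda := (@lebesgue_measure R).
Local Notation iterint := (@iter_lebesgue_integral R _).
Local Notation w := ((2 * N%:R)^-1 : R).

(** The uniform part on [0,1] ensures positivity on the whole interval; the weight [w] splits the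
    other half of the mass equally among the [N] bumps. *)
Definition bump_density (z : R) : R :=
  2^-1 * uniform_pdf 0 1 z + w * \sum_(i < N) uniform_pdf (p i) (r i) z.

Definition cube_bump_density (x : n.+1.-tuple R) : R :=
  bump_density (thead x) * \1_(@unit_cube R n.+1) x.

Let w0 : 0 <= w. Proof. by rewrite invr_ge0 mulr_ge0. Qed.

Lemma bump_density_ge0 z : 0 <= bump_density z.
Proof.
rewrite addr_ge0// mulr_ge0// ?uniform_pdf_ge0//.
by rewrite sumr_ge0// => i _; rewrite uniform_pdf_ge0// pr.
Qed.

Lemma bump_density_gt0 z : 0 <= z <= 1 -> 0 < bump_density z.
Proof.
move=> z01; rewrite ltr_pwDl//.
  by rewrite /uniform_pdf z01 subr0 invr1 mulr1 invr_gt0 ltr0n.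
by rewrite mulr_ge0// sumr_ge0// => i _; rewrite uniform_pdf_ge0// pr.
Qed.

Lemma bump_density_out z : ~~ (0 <= z <= 1) -> bump_density z = 0.
Proof.
move=> z01; rewrite /bump_density {1}/uniform_pdf (negbTE z01) mulr0 add0r.
rewrite big1 ?mulr0// => i _; rewrite /uniform_pdf; case: ifPn => // /andP[? ?].
case/negP: z01; rewrite (le_trans (p0 _ (ltn_ord i)))//=.
by rewrite (le_trans _ (r1 _ (ltn_ord i))).
Qed.

Lemma measurable_bump_density : measurable_fun setT bump_density.
Proof.
apply: measurable_funD; apply: measurable_funM => //.
  exact: measurable_uniform_pdf.
by apply: measurable_sum => i; exact: measurable_uniform_pdf.
Qed.

Lemma integral_bump_density : (\int[lambda]_z (bump_density z)%:E = 1)%E.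
Proof.
under eq_integral do rewrite EFinD !EFinM -sumEFin.
have mu i : measurable_fun setT (fun z => (uniform_pdf (p i) (r i) z)%:E).
  by apply/measurable_EFinP; exact: measurable_uniform_pdf.
have m01 : measurable_fun setT (fun z : R => (uniform_pdf 0 1 z)%:E).
  by apply/measurable_EFinP; exact: measurable_uniform_pdf.
have u0 i z : (i < N)%N -> (0 <= (uniform_pdf (p i) (r i) z)%:E)%E.
  by move=> iN; rewrite lee_fin uniform_pdf_ge0// pr.
have u01 z : (0 <= (uniform_pdf 0 1 z : R)%:E)%E by rewrite lee_fin uniform_pdf_ge0.
have mS : measurable_fun setT
    (fun z => \sum_(i < N) (uniform_pdf (p i) (r i) z)%:E)%E.
  by apply: emeasurable_sum => i.
rewrite ge0_integralD//; last 4 first.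
- by move=> z _; rewrite mule_ge0.
- exact: measurable_funeM.
- by move=> z _; rewrite mule_ge0 ?lee_fin// sume_ge0// => i _; exact: u0.
- exact: measurable_funeM.
rewrite ge0_integralZl// ?lee_fin//.
rewrite integral_uniform_pdf1//.
rewrite ge0_integralZl ?lee_fin//; last first.
  by move=> z _; rewrite sume_ge0// => i _; exact: u0.
rewrite ge0_integral_sum//; last 2 first.
- by move=> i; exact: mu.
- by move=> i z _; exact: u0.
rewrite (eq_bigr (fun=> 1%E)); last first.
  by move=> i _; rewrite integral_uniform_pdf1// pr.
rewrite sumEFin sumr_const card_ord -!EFinM -EFinD; congr EFin.
by field; rewrite pnatr_eq0 -lt0n N0.
Qed.

Lemma measurable_cube_bump_density : measurable_fun setT cube_bump_density.
Proof.
apply: measurable_funM.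
  apply: (measurableT_comp measurable_bump_density).
  exact: measurable_tnth.
by apply: measurable_indic; exact: measurable_unit_cube.
Qed.

(** The first-coordinate factor of the cube indicator is absorbed, because [bump_density] vanishes
    off [0,1]. *)
Lemma cube_bump_density_cons z (y : n.-tuple R) :
  cube_bump_density [tuple of z :: y] =
  bump_density z * \1_(@unit_cube R n) y.
Proof.
rewrite /cube_bump_density indic_unit_cube_cons theadE mulrA; congr (_ * _).
rewrite indicE; have [z01|] := boolP (0 <= z <= 1).
  by rewrite mem_set ?mulr1//= in_itv.
by move=> /bump_density_out->; rewrite mul0r.
Qed.

Lemma measurable_indic_unit_cube :
  measurable_fun setT (fun y : n.-tuple R => (\1_(@unit_cube R n) y : R)%:E).
Proof. by apply: measurable_indic_EFin; exact: measurable_unit_cube. Qed.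

Lemma iterint_cube_bump_density :
  iterint (fun x => (cube_bump_density x)%:E) = 1%E.
Proof.
rewrite -integral_bump_density /=; apply: eq_integral => z _.
under eq_fun do rewrite cube_bump_density_cons EFinM.
rewrite iterintZ ?iterint_unit_cube ?mule1 ?bump_density_ge0//.
exact: measurable_indic_unit_cube.
Qed.

(** The normalisation of the uniform density cancels the Jacobian, so integrals over bumps of
    different lengths share one parameter interval. *)
Lemma integral_uniform_pdf_affine (a b : R) (G : R -> \bar R) :
  a < b -> measurable_fun setT G -> (forall x, 0 <= G x)%E ->
  (\int[lambda]_z ((uniform_pdf a b z)%:E * G z) =
   \int[lambda]_(t in `[0%R, 1%R]) G (a + t * (b - a))%R)%E.
Proof.
move=> ab mG G0.
transitivity (\int[lambda]_(z in `[a, b]) ((b - a)^-1%:E * G z))%E.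
  rewrite [RHS]integral_mkcond; apply: eq_integral => z _.
  rewrite patchE /uniform_pdf; have [zab|zab] := boolP (a <= z <= b).
    by rewrite mem_set//= in_itv.
  by rewrite mul0e memNset//= in_itv/= => zab'; rewrite zab' in zab.
rewrite ge0_integralZl//; last 2 first.
- exact: measurable_funTS.
- by rewrite lee_fin invr_ge0 subr_ge0 ltW.
rewrite ge0_integral_affine// muleA -EFinM mulVf ?mul1e//.
by rewrite gt_eqF// subr_gt0.
Qed.

(** In the application [B i] is where the thresholded [g] disagrees with the parity of [i]. Since
    [h] does not occur here, measurability rests on the sets [B i] alone. *)
Definition bump_error (B : nat -> set (n.+1.-tuple R)) : set (n.+1.-tuple R) :=
  @unit_cube R n.+1 `&`
  \bigcup_(i in `I_N) ([set x | p i <= thead x <= r i] `&` B i).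

Lemma measurable_bump_error (B : nat -> set (n.+1.-tuple R)) :
  (forall i, measurable (B i)) -> measurable (bump_error B).
Proof.
move=> mB; apply: measurableI; first exact: measurable_unit_cube.
apply: bigcup_measurable => i _; apply: measurableI => //.
rewrite (_ : [set _ | _] = (fun x : n.+1.-tuple R => tnth x ord0) @^-1` `[p i, r i]%classic).
  by rewrite -[X in measurable X]setTI; exact: measurable_tnth.
by apply/seteqP; split => x /=; rewrite in_itv.
Qed.

End BumpDensity.

(** * Mass of the error set *)

Section BumpErrorBound.
Variables (R : realType) (n N : nat) (p r : nat -> R).
Hypothesis N0 : (0 < N)%N.
Hypothesis p0 : forall i, (i < N)%N -> 0 <= p i.
Hypothesis pr : forall i, (i < N)%N -> p i < r i.
Hypothesis r1 : forall i, (i < N)%N -> r i <= 1.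
Variables (B : nat -> set (n.+1.-tuple R)) (M : R).
Hypothesis mB : forall i, measurable (B i).
Hypothesis M0 : 0 <= M.
Hypothesis BM : forall (t : R) (y : n.-tuple R), 0 <= t <= 1 ->
  M <= \sum_(i < N) \1_(B i) [tuple of p i + t * (r i - p i) :: y].
Local Notation lambda := (@lebesgue_measure R).
Local Notation iterint := (@iter_lebesgue_integral R _).
Local Notation w := ((2 * N%:R)^-1 : R).
Local Notation E := (bump_error R n N p r B).
Local Notation rho := (cube_bump_density R n N p r).

Let w0 : 0 <= w. Proof. by rewrite invr_ge0 mulr_ge0. Qed.

(** Only [y] needs a cube indicator: the factor [u i z] below confines [z] to the i-th bump. *)
Let S i (z : R) (y : n.-tuple R) : \bar R :=
  ((\1_(B i) [tuple of z :: y] : R) * \1_(@unit_cube R n) y)%:E.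

Let S0 i z y : (0 <= S i z y)%E.
Proof. by rewrite lee_fin mulr_ge0. Qed.

Let mS2 i : measurable_fun setT (fun x : R * n.-tuple R => S i x.1 x.2).
Proof.
apply/measurable_EFinP; apply: measurable_funM.
  apply: (@measurableT_comp _ _ _ _ _ _ (\1_(B i) : n.+1.-tuple R -> R)).
    exact: measurable_indic.
  exact: measurable_tuple_cons.
apply: (@measurableT_comp _ _ _ _ _ _ (\1_(@unit_cube R n) : n.-tuple R -> R)) => //.
by apply: measurable_indic; exact: measurable_unit_cube.
Qed.

Let mS i z : measurable_fun setT (S i z).
Proof.
have mz : measurable_fun setT (fun y : n.-tuple R => (z, y)).
  exact: measurable_fun_pair.
exact: (measurableT_comp (mS2 i) mz).
Qed.

Let G i (z : R) : \bar R := iterint (S i z).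

Let G0 i z : (0 <= G i z)%E. Proof. exact: iterint_ge0. Qed.

Let mG i : measurable_fun setT (G i).
Proof. by apply: (measurable_iterint_param _ _ _ _ _ (mS2 i)) => -[]. Qed.

Let mGaff i : measurable_fun setT (fun t : R => G i (p i + t * (r i - p i))).
Proof.
apply: (measurableT_comp (mG i)).
by apply: measurable_funD => //; apply: measurable_funM.
Qed.

Let u i (z : R) : R := uniform_pdf (p i) (r i) z.

Let u0 i z : (i < N)%N -> 0 <= u i z.
Proof. by move=> iN; rewrite uniform_pdf_ge0// pr. Qed.

Let mu_ i : measurable_fun setT (fun z => (u i z)%:E).
Proof. by apply/measurable_EFinP; exact: measurable_uniform_pdf. Qed.

Let mwu i : measurable_fun setT (fun z => (w * u i z)%:E).
Proof.
apply/measurable_EFinP; apply: measurable_funM => //.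
exact: measurable_uniform_pdf.
Qed.

(** On [E] the left side is at most the bump part of the density. Off [E] every term vanishes, since
    a nonzero one would place the point in the cube, over bump [i] and in [B i]. *)
Let density_ge z y :
  (\sum_(i < N) ((w * u i z)%:E * S i z y) <=
   ((\1_E [tuple of z :: y] : R) * rho [tuple of z :: y])%:E)%E.
Proof.
rewrite /S; under eq_bigr do rewrite -EFinM.
rewrite sumEFin lee_fin cube_bump_density_cons//.
have [Ezy|nEzy] := pselect (E [tuple of z :: y]).
  have [/unit_cube_cons[_ yc] _] := Ezy.
  have -> : \1_E [tuple of z :: y] = 1 :> R by rewrite indicE mem_set.
  have -> : \1_(@unit_cube R n) y = 1 :> R by rewrite indicE mem_set.
  rewrite mul1r mulr1.
  rewrite /bump_density mulr_sumr -[leLHS]add0r lerD//.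
    by rewrite mulr_ge0// uniform_pdf_ge0.
  apply: ler_sum => i _; rewrite mulr1 ler_piMr ?mulr_ge0 ?u0//.
have -> : \1_E [tuple of z :: y] = 0 :> R by rewrite indicE memNset.
rewrite mul0r big1// => i _.
have [Bi|nB] := pselect (B i [tuple of z :: y]); last first.
  have -> : \1_(B i) [tuple of z :: y] = 0 :> R by rewrite indicE memNset.
  by rewrite mul0r mulr0.
have [yc|nyc] := pselect (unit_cube y); last first.
  have -> : \1_(@unit_cube R n) y = 0 :> R by rewrite indicE memNset.
  by rewrite !mulr0.
rewrite /u /uniform_pdf; case: ifPn => [zi|]; last by rewrite mulr0 mul0r.
case: nEzy; split.
  apply/unit_cube_cons; split => //; move/andP: zi => [zi1 zi2].
  by rewrite (le_trans (p0 _ (ltn_ord i)))//= (le_trans zi2)// r1.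
by exists i => //=; split.
Qed.

(* Each bump is rescaled to [0,1]; the sum over the bumps is then bounded
   pointwise in the common parameter [t] and in [y]. *)
Lemma bump_error_ge :
  ((M * w)%:E <= iterint (fun x => ((\1_E x : R) * rho x)%:E))%E.
Proof.
have mE : measurable E by exact: measurable_bump_error.
have mR : measurable_fun setT
    (fun x : n.+1.-tuple R => ((\1_E x : R) * rho x)%:E).
  apply/measurable_EFinP; apply: measurable_funM; first exact: measurable_indic.
  exact: measurable_cube_bump_density.
have R0 (x : n.+1.-tuple R) : (0 <= ((\1_E x : R) * rho x)%:E)%E.
  by rewrite lee_fin mulr_ge0// mulr_ge0// bump_density_ge0.
have term0 (i : 'I_N) z y : (0 <= (w * u i z)%:E * S i z y)%E.
  by rewrite mule_ge0// lee_fin mulr_ge0// u0.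
have mterm (i : 'I_N) z : measurable_fun setT (fun y => (w * u i z)%:E * S i z y)%E.
  exact: measurable_funeM.
(* [density_ge] is integrated in [y] first, which turns each [S i z] into its slice integral
   [G i z]. *)
apply: (@le_trans _ _ (\int[lambda]_z \sum_(i < N) ((w * u i z)%:E * G i z)))%E;
  last first.
  apply: ge0_le_integral => //.
  - move=> z _; apply: sume_ge0 => i _; rewrite mule_ge0// lee_fin mulr_ge0//.
    exact: u0.
  - by apply: emeasurable_sum => i; exact: (emeasurable_funM (mwu i) (mG i)).
  - exact: (measurable_iterint_cons _ _ _ mR R0).
  - move=> z _.
    apply: (@le_trans _ _
        (iterint (fun y => \sum_(i < N) ((w * u i z)%:E * S i z y))))%E.
      rewrite iterint_sum//; apply: lee_sum => i _.
      by rewrite iterintZ// mulr_ge0// u0.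
    apply: le_iterint => //.
    + exact: emeasurable_sum.
    + exact: (measurable_cons_section _ _ _ z mR).
    + by move=> y; apply: sume_ge0 => i _.
rewrite ge0_integral_sum//; last 2 first.
- by move=> i; exact: (emeasurable_funM (mwu i) (mG i)).
- by move=> i z _; rewrite mule_ge0// lee_fin mulr_ge0// u0.
have termE (i : 'I_N) : (\int[lambda]_z ((w * u i z)%:E * G i z) =
    w%:E * \int[lambda]_(t in `[0%R, 1%R]) G i (p i + t * (r i - p i))%R)%E.
  under eq_integral do rewrite EFinM -muleA.
  rewrite ge0_integralZl ?lee_fin//.
  - by rewrite integral_uniform_pdf_affine// pr.
  - exact: (emeasurable_funM (mu_ i) (mG i)).
  - by move=> z _; rewrite mule_ge0// lee_fin u0.
rewrite (eq_bigr _ (fun i _ => termE i)).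
rewrite -ge0_sume_distrr; last by move=> i _; apply: integral_ge0 => t _.
rewrite mulrC EFinM lee_wpmul2l ?lee_fin//.
rewrite -ge0_integral_sum//; last by move=> i; exact: (measurable_funTS (mGaff i)).
have -> : M%:E = (\int[lambda]_(t in `[0%R, 1%R]) M%:E)%E.
  by rewrite integral_cst//= lebesgue_measure_itv/= lte01 oppr0 adde0 mule1.
apply: ge0_le_integral => //.
- by apply: emeasurable_sum => i; exact: (measurable_funTS (mGaff i)).
move=> t; rewrite /= in_itv/= => t01.
(* [M] is written as [M] times the volume of the cube in [y], so that [BM] can be compared under the
   integral. *)
rewrite -iterint_sum// -[leLHS]mule1 -(iterint_unit_cube R n) -iterintZ//;
  last exact: measurable_indic_unit_cube.
apply: le_iterint.
- by apply: measurable_funeM; exact: measurable_indic_unit_cube.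
- exact: emeasurable_sum.
- by move=> y; rewrite mule_ge0// lee_fin.
- move=> y; rewrite sumEFin -EFinM lee_fin -mulr_suml ler_wpM2r//.
  exact: BM.
Qed.

End BumpErrorBound.

(** * The four lower bounds *)

(** The cells cover the point 0, so [m] is positive and [2 ^ k] is at least 4; this absorbs the
    off-by-one losses in the counts below. *)
Lemma error_count_le (R : realType) (k : nat) (u : R -> R) (x : nat -> R) N :
  Cr_le u (2 ^+ k / 4) -> (forall i, (i < N)%N -> x i <= x i.+1) ->
  exists2 m, (0 < m)%N & (4 * m <= 2 ^ k)%N /\
    (N <= (\sum_(i < N.+1) (odd i != (2^-1 <= u (x i))%R)).*2 + m)%N.
Proof.
move=> [m [cm mk]] xinc; exists m.
  by case: cm => I [_ _ _ Icov _]; have [i _] := Icov 0; rewrite (leq_trans _ (ltn_ord i)).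
split; last exact: (crossing_partition_errors _ _ _ _ _ cm xinc).
by move: mk; rewrite ler_pdivlMr// -natrM -natrX ler_nat mulnC.
Qed.

(* The dimension is d = n.+1 (i.e. d >= 1); points of R^d are d.-tuples,
   x_1 = thead x, and p_y z = (z, y) = [tuple of z :: y]. *)
Theorem theorem3p12 (R : realType) (k n : nat) (f : R -> R) :
  (1 <= k)%N ->
  triangle 1 0 1 f ->
  let h : n.+1.-tuple R -> R := fun x => iter k f (thead x) in
  exists (mu : probability (n.+1.-tuple R) R) (P : 'I_(2 ^ k).+1 -> n.+1.-tuple R),
    [/\ has_cube_density mu,
        injective P,
        (forall i, unit_cube (P i)) &
        forall g : n.+1.-tuple R -> R,
          measurable_fun setT g ->
          (forall y : n.-tuple R,
              Cr_le (fun z => g [tuple of z :: y]) ((2 ^+ k) / 4)) ->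
          [/\ (\int[mu]_x (`|h x - g x|)%:E >= (1 / 32)%:E)%E,
              (\int[mu]_x (`|thr h x - thr g x|)%:E >= (1 / 8)%:E)%E,
              (\sum_(i < (2 ^ k).+1) `|h (P i) - g (P i)|) / ((2 ^ k).+1)%:R >= 1 / 8 &
              (\sum_(i < (2 ^ k).+1) `|thr h (P i) - thr g (P i)|) / ((2 ^ k).+1)%:R
                >= 1 / 4]].
Proof.
move=> k1 tf h.
have [p [r [p01 prp pE hK]]] := triangle1_iter_bumps _ _ k tf.
set N := (2 ^ k)%N in p01 prp pE hK *.
have N0 : (0 < N)%N by rewrite expn_gt0.
have p0 i : (i < N)%N -> 0 <= p i by move=> /ltnW/p01/andP[].
have pr i : (i < N)%N -> p i < r i by move=> /prp/andP[].
have r1 i : (i < N)%N -> r i <= 1.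
  by move=> iN; have /andP[_ /le_trans] := prp _ iN; apply; have /andP[] := p01 _ iN.
have pinc i : (i < N)%N -> p i < p i.+1.
  by move=> iN; have /andP[/lt_le_trans] := prp _ iN; apply.
pose rho := cube_bump_density R n N p r.
have mrho : measurable_fun setT rho by exact: measurable_cube_bump_density.
have rho_ge0 x : 0 <= rho x by rewrite mulr_ge0// bump_density_ge0.
have [|mu muE] := density_probability R n.+1 rho mrho rho_ge0.
  exact: iterint_cube_bump_density.
(* The atoms of the discrete measure all lie on the single line [p_y] with [y] = 0. *)
pose y0 : n.-tuple R := [tuple of nseq n 0].
exists mu, (fun i => [tuple of p i :: y0]); split.
- exists rho; split => //.
  + move=> x xc; rewrite /rho /cube_bump_density indicE mem_set// mulr1.
    by apply: bump_density_gt0 => //; exact: xc.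
  + by move=> x xc; rewrite /rho /cube_bump_density indicE memNset// mulr0.
- have pmono i j : (i < j <= N)%N -> p i < p j.
    move=> /andP[]; elim: j => // j IH; rewrite ltnS leq_eqVlt => /predU1P[->|ij] jN.
      exact: pinc.
    by rewrite (lt_trans (IH ij (ltnW jN)))// pinc.
  move=> i j /(congr1 (@thead _ _)); rewrite !theadE => pij; apply/val_inj => /=.
  have iN := ltn_ord i; have jN := ltn_ord j; rewrite !ltnS in iN jN.
  case: (ltngtP i j) => // ij.
    by have := pmono i j; rewrite ij jN pij ltxx => /(_ isT).
  by have := pmono j i; rewrite ij iN pij ltxx => /(_ isT).
- move=> i; apply/unit_cube_cons; split; first by apply: p01; rewrite -ltnS.
  by move=> j; rewrite tnth_nseq lexx ler01.
move=> g mg Crg.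
pose B i := [set x | odd i != (2^-1 <= g x)].
have mge : measurable [set x | 2^-1 <= g x].
  rewrite (_ : [set _ | _] = g @^-1` `[2^-1, +oo[%classic).
    by rewrite -[X in measurable X]setTI; exact: mg.
  by apply/seteqP; split => x /=; rewrite in_itv/= andbT.
have mB i : measurable (B i).
  rewrite /B; case: (odd i).
    rewrite (_ : [set _ | _] = ~` [set x | 2^-1 <= g x]); first exact: measurableC.
    by apply/seteqP; split => x /=; case: (2^-1 <= g x).
  rewrite (_ : [set _ | _] = [set x | 2^-1 <= g x])//.
  by apply/seteqP; split => x /=; case: (2^-1 <= g x).
pose E := bump_error R n N p r B.
have mE : measurable E by exact: measurable_bump_error.
have muEge : ((1 / 8)%:E <= mu E)%E.
  rewrite muE.
  (* [M] is N/4: for each [t] and [y], at least a quarter of the bumps carry an error. *)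
  have -> : 1 / 8 = N%:R / 4 * (2 * N%:R)^-1 :> R.
    by field; rewrite pnatr_eq0 -lt0n N0.
  apply: bump_error_ge => // t y /andP[t0 t1].
  (* There is one sample point per bump, [N] in all, hence only N - 1 neighbouring pairs. *)
  have [N' NE] : exists N', N = N'.+1 by exists N.-1; rewrite prednK.
  have [i iN|m m0 [m4 mN]] := error_count_le _ _ _
      (fun i => p i + t * (r i - p i)) N' (Crg y).
    have iN1 : (i < N)%N by rewrite NE ltnW.
    have iN2 : (i.+1 < N)%N by rewrite NE ltnS.
    have /andP[pi ri] := prp _ iN1; have /andP[pi2 ri2] := prp _ iN2.
    (* The i-th point is at most [r i], hence at most [p i.+1], hence at most the next point. *)
    by rewrite /=; nra.
  rewrite (eq_bigr (fun i : 'I_N => (odd i != (2^-1 <= g [tuple of p i + t * (r i - p i) :: y]))%:R)).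
    rewrite -natr_sum ler_pdivrMr// -natrM ler_nat.
    rewrite -NE /= in mN; rewrite -/N in m4.
    by move: mN; set S := (\sum_(i < N) _)%N => mN; lia.
  move=> i _; rewrite indicE; congr (_%:R); congr nat_of_bool.
  by apply/idP/idP; rewrite inE.
have EP x : E x -> exists i, [/\ odd i != (2^-1 <= g x) & `|h x - (odd i)%:R| <= 4^-1].
  by move=> [_ [i /= iN [xi Bx]]]; exists i; split => //; exact: hK.
pose S := (\sum_(i < N.+1) (odd i != (2^-1 <= g [tuple of p i :: y0])%R))%N.
(* Here all N + 1 points are sampled, and at least a quarter of them are errors. *)
have S4 : N.+1%:R <= S%:R * 4 :> R.
  have [m m0 [m4 mN]] :=
    error_count_le _ _ _ p N (Crg y0) (fun i iN => ltW (pinc i iN)).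
  by rewrite -natrM ler_nat; rewrite -/N in m4; rewrite -/S in mN; lia.
split.
(* On [E], [h] is within 1/4 of the parity and [g] is across 1/2, so they differ by at least 1/4. *)
- apply: (@le_trans _ _ ((1 / 4)%:E * mu E)%E).
    have -> : 1 / 32 = 1 / 4 * (1 / 8) :> R by field.
    by rewrite EFinM lee_wpmul2l.
  apply: ge0_integral_ge_indic => //.
  + move=> x /EP[i [ogx]]; rewrite ler_norml => /andP[l1 l2].
    move: ogx l1 l2; rewrite ler_normr.
    by case: (odd i); case: (leP 2^-1 (g x)) => //= gx _ l1 l2; apply/orP; [left|right]; lra.
- rewrite -[leLHS]mule1 -[X in (_ * X)%E]/(1%:E) muleC.
  apply: (@le_trans _ _ (1%:E * mu E)%E); first by rewrite lee_wpmul2l.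
  (* On [E] the thresholded [h] equals the parity, so the thresholded functions differ by 1. *)
  apply: ge0_integral_ge_indic => //.
  move=> x /EP[i [ogx]]; rewrite ler_norml => /andP[l1 l2].
  move: ogx l1 l2; rewrite /thr.
  case: (odd i); case: (leP 2^-1 (g x)) => //= gx _ l1 l2.
    have -> : 2^-1 <= h x by lra.
    by rewrite subr0 normr1.
  have -> : (2^-1 <= h x) = false by apply/negbTE; rewrite -ltNge; lra.
  by rewrite sub0r normrN normr1.
(* At the atoms [h] is exactly 0 or 1, so each error costs at least 1/2, and 1 after thresholding in
   the last bound. *)
- rewrite ler_pdivlMr ?ltr0n//; apply: (@le_trans _ _ (S%:R / 2)); first by lra.
  rewrite natr_sum mulr_suml; apply: ler_sum => i _.
  rewrite /h theadE pE; last by rewrite -ltnS.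
  case: (odd i); case: (leP 2^-1 (g _)) => /= gx; rewrite ?mul0r ?normr_ge0//;
    by rewrite ler_normr; apply/orP; first [left; lra | right; lra].
- rewrite ler_pdivlMr ?ltr0n//; apply: (@le_trans _ _ S%:R); first by lra.
  rewrite natr_sum; apply: ler_sum => i _.
  rewrite /thr /h theadE pE; last by rewrite -ltnS.
  have -> : (2^-1 <= (odd i)%:R :> R) = odd i.
    by case: (odd i) => /=; [apply/idP; lra|apply/negbTE; rewrite -ltNge; lra].
  case: (odd i); case: (2^-1 <= g _) => /=;
    by rewrite ?subrr ?subr0 ?sub0r ?normrN ?normr1 ?normr0.
Qed.
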